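(* Let $m \geq 1$ and $n \geq 2m$ be integers, and let $n_0$ be the integer attached to $n$ as defined in the context. The set $\tilde{J}(n,m)$, regarded as a subset of the $(n-1)$-dimensional Euclidean space $H_{n,m}=\{(x_1,\dots,x_n)\in\mathbb{R}^n : \sum_i x_i=m\}\simeq\mathbb{R}^{n-1}$, is not maximal as an $m$-distance set in $H_{n,m}$ if and only if $$n>n_0\qquad\text{and}\qquad 3n_0-\frac{n_0^2}{n}\leq 4m .$$ Furthermore, if the pair $(n,m)$ satisfies these two conditions, then each vector $x$ of the following set can be added to $\tilde{J}(n,m)$ while maintaining $m$-distance (i.e. $\tilde{J}(n,m)\cup\{x\}$ is an $m$-distance set): $$\begin{cases}\left(\left(\frac{n_0}{n}\right)^{n-n_0+m},\ \left(-1+\frac{n_0}{n}\right)^{n_0-m}\right)^P & \text{if } m<n_0,\\[4pt] \left(\left(\frac{m}{n}\right)^n\right) & \text{if } m=n_0,\\[4pt] \left(\left(1+\frac{n_0}{n}\right)^{m-n_0},\ \left(\frac{n_0}{n}\right)^{n+n_0-m}\right)^P & \text{if } m>n_0.\end{cases}$$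
   Context: Notation: $(a_1^{r_1},\dots,a_t^{r_t})^P$ denotes the set of all vectors obtained by permuting the coordinates of the vector in which $a_i$ occurs $r_i$ times; inside the parentheses exponents are multiplicities, not powers. $((a)^n)$ is the (set consisting of the) constant vector $(a,\dots,a)\in\mathbb{R}^n$. $\tilde{J}(n,m)=(1^m,0^{n-m})^P\subset\mathbb{R}^n$ is the set of all $0/1$ vectors of length $n$ with exactly $m$ ones (the representation of the Johnson graph $J(n,m)$). It lies in the hyperplane $H_{n,m}=\{\sum_i x_i=m\}$, which is identified with $\mathbb{R}^{n-1}$. A finite subset of a Euclidean space is an $s$-distance set if exactly $s$ distinct values occur as Euclidean distances between distinct points of it. For $n\ge 2m$, $\tilde J(n,m)$ is an $m$-distance set. An $s$-distance set is maximal in a given space if no other $s$-distance set in that space contains it. Definition of $n_0$: write $n=2^{e_0}\prod_{i>0}p_i^{e_i}$ with distinct odd primes $p_i$ and exponents $e_i\ge 0$. Then $$n_0=\prod_{i>0}p_i^{\lceil e_i/2\rceil}\ \text{ if } e_0=0,\qquad n_0=2^{\lceil (e_0+1)/2\rceil}\prod_{i>0}p_i^{\lceil e_i/2\rceil}\ \text{ if } e_0>0 .$$ *)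

(* Defs.v *)
From mathcomp Require Import all_boot all_order all_algebra.
From mathcomp Require Import all_classical all_reals.

Set Implicit Arguments.
Unset Strict Implicit.
Unset Printing Implicit Defensive.

Import Order.TTheory GRing.Theory Num.Theory.

Local Open Scope classical_set_scope.
Local Open Scope ring_scope.

(* The norm that MathComp-Analysis puts on 'rV[R]_n is the sup norm, hence the
   explicit Euclidean distance. *)
Definition eucl_dist (R : realType) (n : nat) (x y : 'rV[R]_n) : R :=
  Num.sqrt (\sum_(i < n) (x 0 i - y 0 i) ^+ 2).

Definition distances (R : realType) (n : nat) (X : set 'rV[R]_n) : set R :=
  [set d | exists x y, [/\ X x, X y, x <> y & d = eucl_dist x y]].

Definition distance_set (R : realType) (n s : nat) (X : set 'rV[R]_n) : Prop :=
  finite_set X /\ (distances X #= `I_s)%card.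

Definition maximal_distance_set (R : realType) (n s : nat)
    (H X : set 'rV[R]_n) : Prop :=
  [/\ X `<=` H, distance_set s X &
    forall Y : set 'rV[R]_n,
      Y `<=` H -> X `<=` Y -> distance_set s Y -> Y = X].

(* [perm_vectors [:: (a_1, r_1); ...; (a_t, r_t)]] is
   (a_1^{r_1}, ..., a_t^{r_t})^P, exponents being multiplicities; it is empty
   unless r_1 + ... + r_t = n. *)
Definition perm_vectors (R : realType) (n : nat) (l : seq (R * nat)) :
    set 'rV[R]_n :=
  [set x | perm_eq [seq x 0 i | i : 'I_n] (tally_seq l)].

Definition johnson (R : realType) (n m : nat) : set 'rV[R]_n :=
  perm_vectors [:: (1, m); (0, (n - m)%N)].

Definition sum_hyperplane (R : realType) (n m : nat) : set 'rV[R]_n :=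
  [set x | \sum_(i < n) x 0 i = m%:R].

(* [uphalf k] is the ceiling of k / 2. *)
Definition n_zero (n : nat) : nat :=
  ((if logn 2 n == 0%N then 1 else 2 ^ uphalf (logn 2 n).+1) *
   \prod_(p <- primes n | odd p) p ^ uphalf (logn p n))%N.

(* The truncated subtractions are exact when n_zero n < n and 2 m <= n. *)
Definition added_vectors (R : realType) (n m : nat) : set 'rV[R]_n :=
  let n0 := n_zero n in
  let c : R := n0%:R / n%:R in
  if (m < n0)%N then
    perm_vectors [:: (c, (n - n0 + m)%N); (-1 + c, (n0 - m)%N)]
  else if m == n0 then
    [set const_mx (m%:R / n%:R)]
  else
    perm_vectors [:: (1 + c, (m - n0)%N); (c, (n + n0 - m)%N)].

Arguments johnson R n m : clear implicits.
Arguments sum_hyperplane R n m : clear implicits.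
Arguments added_vectors R n m : clear implicits.

(* Main.v *)
(* Up to a constant c, the coordinates of an added point x are integers z_i:
   swapping one element of a support S changes |x - 1_S|^2, an even integer, by
   2 (x_i - x_j).  With t = m - sum z_i = n c, one finds
     |x - 1_S|^2 = sum z_i^2 + m - 2 sum_(i in S) z_i - t^2 / n,
   which is even for all S iff n divides t^2 with quotient of the parity of t,
   that is, iff n_0 divides t.
   Take S, T to be the positions of the m largest and the m smallest
   coordinates.  The distances from x to 1_S and 1_T force the sums of x over S
   and T to differ by less than m, so the nonnegative integers x_s - x_t, for s
   in S and t in T, are not all positive: let c be a value common to S and T.
   Then z >= 0 on S, z <= 0 on T and z = 0 elsewhere, so that 0 < t < n, and the
   bound |x - 1_T|^2 <= 2 m yields 3 t - t^2 / n <= 4 m.  The left-hand side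
   increases with t in this range, so t may be replaced by n_0.
   Conversely t = n_0 is realised with all the z_i in {0, 1} or in {0, -1}. *)
Require Import Defs.
From mathcomp Require Import all_boot all_order all_algebra.
From mathcomp Require Import finmap.
From mathcomp Require Import all_classical all_reals.
From mathcomp Require Import zify ring lra.

Set Implicit Arguments.
Unset Strict Implicit.
Unset Printing Implicit Defensive.

Import Order.TTheory GRing.Theory Num.Theory.

Local Open Scope classical_set_scope.
Local Open Scope ring_scope.

(** * Divisibility by [n_zero n] *)

(** Distinct primes do not interfere, so the [q]-adic valuation sees only the factor at [q], which
    occurs at most once because [s] has no repetitions. *)
Lemma logn_prod_prime_powers (q : nat) (s : seq nat) (P : pred nat)
    (f : nat -> nat) :
  prime q -> uniq s -> {in s, forall p, prime p} ->
  logn q (\prod_(p <- s | P p) p ^ f p)%N =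
    if (q \in s) && P q then f q else 0%N.
Proof.
move=> q_pr; elim: s => [|p s IHs] /= => [_ _|/andP[pNs s_uniq] s_pr].
  by rewrite big_nil logn1.
have p_pr : prime p by apply: s_pr; rewrite mem_head.
have {}s_pr : {in s, forall r, prime r}.
  by move=> r rs; apply: s_pr; rewrite inE rs orbT.
rewrite big_cons inE; have {IHs s_uniq}IHs := IHs s_uniq s_pr.
have prod_gt0 : (0 < \prod_(r <- s | P r) r ^ f r)%N.
  rewrite big_seq_cond; apply: prodn_cond_gt0 => r /andP[rs _].
  by rewrite expn_gt0 prime_gt0 ?s_pr.
case: (eqVneq q p) => [->|q_neq_p] /=.
  have IHp : logn p (\prod_(r <- s | P r) r ^ f r) = 0%N.
    rewrite big_seq_cond; elim/big_ind: _ => [|a b a0 b0|r /andP[rs _]].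
    - by rewrite logn1.
    (* [logn p 0 = 0] by convention, so zero factors are covered as well. *)
    - case: (posnP a) => [->|a_gt0]; first by rewrite mul0n logn0.
      case: (posnP b) => [->|b_gt0]; first by rewrite muln0 logn0.
      by rewrite lognM // a0 b0.
    - rewrite lognX logn_prime ?s_pr //.
      by case: eqVneq rs pNs => [->|_ _ _]; rewrite ?muln0 // => ->.
  case: ifP => _; last exact: IHp.
  by rewrite lognM ?expn_gt0 ?(prime_gt0 p_pr) // IHp lognX logn_prime // eqxx
    muln1 addn0.
case: ifP => _; last exact: IHs.
rewrite lognM ?expn_gt0 ?(prime_gt0 p_pr) // IHs lognX logn_prime //.
by rewrite (negPf q_neq_p) muln0.
Qed.

Lemma dvdn_logn (d n : nat) : (0 < d)%N -> (0 < n)%N ->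
  (d %| n)%N <-> forall p, prime p -> (logn p d <= logn p n)%N.
Proof.
move=> d_gt0 n_gt0; split=> [dn p _|le_dn]; first exact: dvdn_leq_log.
apply/dvdn_partP => // p; rewrite mem_primes => /andP[p_pr _].
by rewrite p_part pfactor_dvdn // le_dn.
Qed.

Lemma n_zero_gt0 (n : nat) : (0 < n_zero n)%N.
Proof.
rewrite muln_gt0; apply/andP; split; first by case: ifP; rewrite ?expn_gt0.
rewrite big_seq_cond; apply: prodn_cond_gt0 => p /andP[+ _].
by rewrite mem_primes expn_gt0 => /andP[/prime_gt0 ->].
Qed.

Lemma logn2_eq0 (n : nat) : (0 < n)%N -> (logn 2 n == 0%N) = odd n.
Proof.
by move=> n_gt0; rewrite eqn0Ngt logn_gt0 mem_primes /= n_gt0 dvdn2 negbK.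
Qed.

(** Doubling an even [n] turns [e_0] into [e_0 + 1] and leaves the odd primes alone. Both cases of
    the definition thus halve, rounding up, the exponents of one number, and [n_zero n] is the least
    positive integer whose square that number divides. *)
Lemma logn_n_zero (n p : nat) : (0 < n)%N -> prime p ->
  logn p (n_zero n) = uphalf (logn p (if odd n then n else 2 * n)%N).
Proof.
move=> n_gt0 p_pr; rewrite /n_zero logn2_eq0 // lognM; last first.
- by move: (n_zero_gt0 n); rewrite muln_gt0 => /andP[].
- by case: ifP; rewrite ?expn_gt0.
rewrite logn_prod_prime_powers ?primes_uniq //; last first.
  by move=> q; rewrite mem_primes => /andP[].
have [->|p_odd] := even_prime p_pr.
  rewrite andbF addn0; case: ifP => n_odd.
    by rewrite logn1; move: (logn2_eq0 n_gt0); rewrite n_odd => /eqP ->.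
  by rewrite lognX lognM // (@logn_prime 2 2) //= muln1.
have -> : (if (p \in primes n) && odd p then uphalf (logn p n) else 0%N) =
    uphalf (logn p n).
  rewrite p_odd andbT; case: ifP => // /negbT.
  by rewrite -logn_gt0 -eqn0Ngt => /eqP ->.
have p2 : (p == 2) = false by case: eqP p_odd => // ->.
case: ifP => _; first by rewrite logn1.
by rewrite lognX lognM // !(@logn_prime p 2) // p2 muln0.
Qed.

(* The parity condition is automatic for odd [n], and means [2 * n %| t ^ 2] for
   even [n]. *)
Lemma n_zero_dvdn (n t : nat) : (0 < n)%N -> (0 < t)%N ->
  (n_zero n %| t)%N <-> exists2 q, (t ^ 2 = n * q)%N & odd q = odd t.
Proof.
move=> n_gt0 t_gt0.
have -> : (exists2 q, (t ^ 2 = n * q)%N & odd q = odd t) <->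
    ((if odd n then n else 2 * n) %| t ^ 2)%N.
  case: ifP => n_odd; split.
  - by case=> q -> _; rewrite dvdn_mulr.
  - case/dvdnP=> q t2; exists q; first by rewrite mulnC.
    by have /(congr1 odd) := t2; rewrite oddX oddM n_odd andbT /= => ->.
  - case=> q t2 q_odd; rewrite t2 mulnC dvdn_pmul2l // dvdn2 q_odd.
    by have /(congr1 odd) := t2; rewrite oddX oddM n_odd /= => ->.
  - case/dvdnP=> q t2; exists (2 * q)%N; first by rewrite t2; lia.
    by have /(congr1 odd) := t2; rewrite oddX !oddM /= andbF => ->.
rewrite !dvdn_logn ?expn_gt0 ?t_gt0 ?n_zero_gt0 //; last by case: ifP; lia.
(* Prime by prime, ceil(a / 2) <= b is equivalent to a <= 2 b. *)
split=> le_t p p_pr; move: (le_t p p_pr);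
  by rewrite logn_n_zero // lognX leq_uphalf_double -mul2n.
Qed.

(** * Distances in the Johnson representation *)

(** As [a] and [b] differ, the positions carrying [a] determine the vector. Conversely, listing [A]
    before its complement sorts the coordinates into two constant blocks. *)
Lemma perm_vectors2P (R : realType) (n r s : nat) (a b : R) (x : 'rV[R]_n) :
  a != b -> (r + s = n)%N ->
  perm_vectors [:: (a, r); (b, s)] x <->
  exists2 A : {set 'I_n}, #|A| = r & x = \row_i (if i \in A then a else b).
Proof.
move=> a_neq_b rs_n.
have tallyE : tally_seq [:: (a, r); (b, s)] = nseq r a ++ nseq s b.
  by rewrite /tally_seq /= cats0.
rewrite /perm_vectors /= tallyE; split=> [px|[A cardA ->]].
  exists [set i | x 0 i == a]%SET.
    have /permP/(_ (pred1 a)) := px.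
    rewrite count_cat !count_nseq /= eqxx mul1n (eq_sym b) (negPf a_neq_b).
    rewrite mul0n addn0 => <-.
    rewrite count_map -sum1_count big_enum_cond -sum1_card.
    by apply: eq_bigl => i; rewrite inE.
  apply/rowP => i; rewrite mxE inE; case: eqP => // xi_neq.
  have : x 0 i \in nseq r a ++ nseq s b.
    by rewrite -(perm_mem px) map_f // mem_enum.
  by rewrite mem_cat !mem_nseq => /orP[] /andP[_ /eqP].
pose f i := if i \in A then a else b.
have -> : [seq (\row_i (if i \in A then a else b)) 0 i | i : 'I_n] =
    [seq f i | i <- enum 'I_n].
  by apply: eq_map => i; rewrite mxE.
have /(perm_map f) :
    perm_eq (enum 'I_n) (enum A ++ enum (~: A)).
  apply: uniq_perm; first exact: enum_uniq.
    rewrite cat_uniq !enum_uniq /= andbT; apply/hasPn => i.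
    by rewrite !mem_enum inE.
  by move=> i; rewrite mem_cat !mem_enum finset.in_setC orbN.
move=> /perm_trans; apply; rewrite map_cat.
have -> : [seq f i | i <- enum A] = nseq r a.
  rewrite -cardA cardE -(size_map f); apply/all_pred1P/allP => _ /mapP[i + ->].
  by rewrite mem_enum /f /= => ->.
have -> : [seq f i | i <- enum (~: A)] = nseq s b.
  have <- : #|~: A| = s by rewrite cardsCs finset.setCK card_ord cardA -rs_n
    addKn.
  rewrite cardE -(size_map f); apply/all_pred1P/allP => _ /mapP[i + ->].
  by rewrite mem_enum finset.in_setC /f /= => /negPf ->.
exact: perm_refl.
Qed.

(** * Subsets of prescribed size *)

Lemma ex_subset_card (T : finType) (B : {set T}) (k : nat) :
  (k <= #|B|)%N -> exists2 A : {set T}, A \subset B & #|A| = k.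
Proof.
move=> k_le; exists [set x in take k (enum B)]%SET.
  by apply/fintype.subsetP => x; rewrite inE => /mem_take; rewrite mem_enum.
rewrite cardsE; have /card_uniqP -> : uniq (take k (enum B)).
  by rewrite take_uniq // enum_uniq.
by rewrite size_takel // -cardE.
Qed.

(** Greedy construction: each step adds a maximiser of [f] on what is left of [B]. Applied to the
    coordinates and to their opposites, it selects the largest and the smallest ones. *)
Lemma ex_top_subset (d : Order.disp_t) (O : orderType d) (T : finType)
    (f : T -> O) (B : {set T}) (k : nat) : (k <= #|B|)%N ->
  exists A : {set T}, [/\ A \subset B, #|A| = k &
    forall x y, x \in A -> y \in B -> y \notin A -> (f y <= f x)%O].
Proof.
elim: k => [|k IHk] k_lt.
  by exists finset.set0; split; rewrite ?finset.sub0set ?cards0 // => x y;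
    rewrite inE.
have [A [AB cardA topA]] := IHk (ltnW k_lt).
have /card_gt0P[x0 x0BA] : (0 < #|B :\: A|)%N.
  by rewrite cardsDS // cardA subn_gt0.
pose x1 := [arg max_(x > x0 in B :\: A) f x]%O.
have [x1BA x1_max] : x1 \in B :\: A /\ {in B :\: A, forall y, (f y <= f x1)%O}.
  by rewrite /x1; case: arg_maxP.
move: x1BA; rewrite finset.in_setD => /andP[x1NA x1B].
exists (x1 |: A); split.
- by rewrite finset.subUset finset.sub1set x1B.
- by rewrite cardsU1 x1NA cardA.
- move=> x y; rewrite finset.in_setU1 => xA yB;
    rewrite finset.in_setU1 negb_or => /andP[_ yNA].
  case/predU1P: xA => [->|xA]; last exact: topA.
  by apply: x1_max; rewrite finset.in_setD yNA.
Qed.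

(** * Squared distances and the distance values of the Johnson set *)

Definition sqdist (R : realType) (n : nat) (x y : 'rV[R]_n) : R :=
  \sum_(i < n) (x 0 i - y 0 i) ^+ 2.

Definition indicator (R : realType) (n : nat) (A : {set 'I_n}) : 'rV[R]_n :=
  \row_i (i \in A)%:R.

(** The [m] values sqrt 2, sqrt 4, ..., sqrt (2 m); the successor excludes distance 0. *)
Definition even_distances (R : realType) (m : nat) : set R :=
  [set Num.sqrt (2 * k.+1)%:R | k in `I_m].

Arguments even_distances R m : clear implicits.

Lemma johnsonP (R : realType) (n m : nat) (x : 'rV[R]_n) : (m <= n)%N ->
  johnson R n m x <-> exists2 A : {set 'I_n}, #|A| = m & x = indicator R A.
Proof.
move=> le_mn; rewrite /johnson perm_vectors2P ?oner_neq0 ?subnKC //.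
by split=> -[A cardA ->]; exists A => //; apply/rowP => i; rewrite !mxE;
  case: (i \in A).
Qed.

Lemma sqdist_ge0 (R : realType) (n : nat) (x y : 'rV[R]_n) : 0 <= sqdist x y.
Proof. by apply: sumr_ge0 => i _; rewrite sqr_ge0. Qed.

Lemma sqdist_eq0 (R : realType) (n : nat) (x y : 'rV[R]_n) :
  (sqdist x y == 0) = (x == y).
Proof.
rewrite psumr_eq0 => [|i _]; last by rewrite sqr_ge0.
apply/allP/eqP => [xy|-> i _]; last by rewrite subrr expr0n eqxx implybT.
apply/rowP => i; apply/eqP; move: (xy i (mem_index_enum i)).
by rewrite /= sqrf_eq0 subr_eq0.
Qed.

Lemma eucl_distC (R : realType) (n : nat) (x y : 'rV[R]_n) :
  eucl_dist x y = eucl_dist y x.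
Proof.
by congr Num.sqrt; apply: eq_bigr => i _; rewrite -sqrrN opprB.
Qed.

Lemma sum_indicator (R : realType) (n : nat) (A : {set 'I_n}) (f : 'I_n -> R) :
  \sum_i f i * indicator R A 0 i = \sum_(i in A) f i.
Proof.
rewrite [RHS]big_mkcond; apply: eq_bigr => i _; rewrite mxE.
by case: ifP; rewrite ?mulr1 ?mulr0.
Qed.

(** Entries of an indicator are idempotent, so [A] enters only through its size and the sum of [x]
    over it. *)
Lemma sqdist_indicator (R : realType) (n : nat) (x : 'rV[R]_n)
    (A : {set 'I_n}) :
  sqdist x (indicator R A) =
    \sum_i x 0 i ^+ 2 + #|A|%:R - 2 * \sum_(i in A) x 0 i.
Proof.
rewrite -sum_indicator -sum1_card natr_sum -sum_indicator mulr_sumr.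
rewrite -big_split -sumrB; apply: eq_bigr => i _ /=; rewrite mxE.
by case: (i \in A) => /=; ring.
Qed.

Lemma sqdist_indicators (R : realType) (n : nat) (A B : {set 'I_n}) :
  #|A| = #|B| -> sqdist (indicator R A) (indicator R B) = (2 * #|A :\: B|)%:R.
Proof.
move=> cardAB; rewrite sqdist_indicator.
have -> : \sum_i indicator R A 0 i ^+ 2 = #|A|%:R.
  rewrite -sum1_card natr_sum -sum_indicator; apply: eq_bigr => i _.
  by rewrite mul1r mxE; case: (i \in A); rewrite ?expr1n ?expr0n.
have -> : \sum_(i in B) indicator R A 0 i = #|A :&: B|%:R.
  rewrite -sum1_card natr_sum [RHS]big_mkcond [LHS]big_mkcond.
  apply: eq_bigr => i _.
  by rewrite mxE finset.in_setI; case: (i \in A); case: (i \in B).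
by rewrite -cardAB -(cardsID B A) natrM !natrD; lra.
Qed.

Lemma even_distances_eucl (R : realType) (n m : nat) (x y : 'rV[R]_n) :
  even_distances R m (eucl_dist x y) <->
  exists2 k, (0 < k <= m)%N & sqdist x y = (2 * k)%:R.
Proof.
rewrite /eucl_dist -/(sqdist x y); split=> [[k /= k_lt]|[[//|k] k_lt ->]].
  move=> /eqP; rewrite eqr_sqrt ?ler0n ?sqdist_ge0 // => /eqP <-.
  by exists k.+1.
by exists k.
Qed.

Lemma card_even_distances (R : realType) (m : nat) :
  (even_distances R m #= `I_m)%card.
Proof.
apply: inj_card_eq => k l _ _ /eqP.
by rewrite eqr_sqrt ?ler0n // eqr_nat eqn_mul2l /= => /eqP[].
Qed.

Lemma finite_johnson (R : realType) (n m : nat) : (m <= n)%N ->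
  finite_set (johnson R n m).
Proof.
move=> le_mn; apply: (@sub_finite_set _ _ (range (@indicator R n))).
  by move=> x /(johnsonP _ le_mn)[A _ ->]; exists A.
exact/finite_image/finite_finset.
Qed.

Lemma johnson_even_distances (R : realType) (n m : nat) (x y : 'rV[R]_n) :
  (m <= n)%N -> johnson R n m x -> johnson R n m y -> x <> y ->
  even_distances R m (eucl_dist x y).
Proof.
move=> le_mn /(johnsonP _ le_mn)[A cardA ->] /(johnsonP _ le_mn)[B cardB ->].
move=> AB_neq; apply/even_distances_eucl; exists #|A :\: B|; last first.
  by rewrite sqdist_indicators // cardA.
rewrite -cardA subset_leq_card ?finset.subsetDl // andbT card_gt0.
apply/negP => /eqP AB0; apply/AB_neq/eqP; rewrite -sqdist_eq0.
by rewrite sqdist_indicators ?cardA // AB0 cards0 muln0.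
Qed.

(** A part [C] of [A] is kept and [k.+1] elements [E] from outside replace the others; [2 * m <= n]
    makes the complement of [A] large enough. *)
Lemma even_distances_johnson (R : realType) (n m : nat) : (2 * m <= n)%N ->
  even_distances R m `<=` distances (johnson R n m).
Proof.
move=> le_2m_n _ [k /= k_lt <-]; have le_mn : (m <= n)%N by lia.
have [|A _ cardA] := @ex_subset_card _ [set: 'I_n]%SET m.
  by rewrite cardsT card_ord.
have [|C CA cardC] := @ex_subset_card _ A (m - k.+1); first by rewrite cardA;
  lia.
have cardAC : #|~: A| = (n - m)%N by rewrite cardsCs finset.setCK card_ord
  cardA.
have [|E EA cardE] := @ex_subset_card _ (~: A) k.+1; first by rewrite cardAC;
  lia.
have CE0 : C :&: E = finset.set0.
  apply/setP => i; rewrite !inE; apply/negP => /andP[/(fintype.subsetP CA) iA].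
  by move=> /(fintype.subsetP EA); rewrite !inE iA.
have cardCE : #|C :|: E| = m by rewrite cardsU CE0 cards0 cardC cardE; lia.
have ADCE : A :\: (C :|: E) = A :\: C.
  apply/setP => i; rewrite !inE; case: (boolP (i \in E)); last by rewrite orbF.
  by move=> /(fintype.subsetP EA); rewrite !inE => /negPf ->; rewrite !andbF.
have dAB : sqdist (indicator R A) (indicator R (C :|: E)) = (2 * k.+1)%:R.
  rewrite sqdist_indicators ?cardCE // ADCE cardsDS // cardA cardC.
  by congr (_ * _)%:R; lia.
exists (indicator R A), (indicator R (C :|: E)); split.
- by apply/johnsonP => //; exists A.
- by apply/johnsonP => //; exists (C :|: E).
- by move/eqP; rewrite -sqdist_eq0 dAB pnatr_eq0.
- by rewrite /eucl_dist -/(sqdist _ _) dAB.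
Qed.

Lemma distances_johnson (R : realType) (n m : nat) : (2 * m <= n)%N ->
  distances (johnson R n m) = even_distances R m.
Proof.
move=> le_2m_n; apply/seteqP; split; last exact: even_distances_johnson.
move=> _ [x [y [xJ yJ xy ->]]]; apply: (@johnson_even_distances _ n) => //.
by lia.
Qed.

Lemma distance_set_johnson (R : realType) (n m : nat) : (2 * m <= n)%N ->
  distance_set m (johnson R n m).
Proof.
move=> le_2m_n; split; first by apply: finite_johnson; lia.
by rewrite distances_johnson //; apply: card_even_distances.
Qed.

(** The distances from [x] are among the values that the Johnson set already realises, so their
    number stays [m]. *)
Lemma distance_set_johnsonU1 (R : realType) (n m : nat) (x : 'rV[R]_n) :
  (2 * m <= n)%N ->
  (forall y, johnson R n m y -> even_distances R m (eucl_dist x y)) ->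
  distance_set m (johnson R n m `|` [set x]).
Proof.
move=> le_2m_n xJ; have le_mn : (m <= n)%N by lia.
split; first by rewrite finite_setU; split; [exact: finite_johnson|].
have -> : distances (johnson R n m `|` [set x]) = even_distances R m.
  apply/seteqP; split=> [_ [y [z [yJx zJx yz ->]]]|d].
    case: yJx zJx yz => [yJ|->] [zJ|->] yz //.
    - exact: (@johnson_even_distances _ n).
    - by rewrite eucl_distC; apply: xJ.
    - exact: xJ.
  move=> /(even_distances_johnson le_2m_n)[y [z [yJ zJ yz ->]]].
  by exists y, z; split=> //; left.
exact: card_even_distances.
Qed.

Lemma card_subset_eq (T : choiceType) (A B : set T) (k : nat) :
  A `<=` B -> (A #= `I_k)%card -> (B #= `I_k)%card -> A = B.
Proof.
move=> AB cardA cardB.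
have finA : finite_set A by apply/finite_setP; exists k.
have finB : finite_set B by apply/finite_setP; exists k.
rewrite -(fset_setK finA) -(fset_setK finB).
have -> // : fset_set A = fset_set B.
apply/eqP; rewrite eqEfcard (card_fset_set cardA) (card_fset_set cardB) leqnn
  andbT.
by rewrite -fset_set_sub.
Qed.

(** The distances of [Y] include the [m] values of the Johnson set and number [m] themselves, so [Y]
    has no others. *)
Lemma distance_set_johnson_sup (R : realType) (n m : nat) (Y : set 'rV[R]_n)
    (x y : 'rV[R]_n) :
  (2 * m <= n)%N -> johnson R n m `<=` Y -> distance_set m Y ->
  Y x -> ~ johnson R n m x -> johnson R n m y ->
  even_distances R m (eucl_dist x y).
Proof.
move=> le_2m_n JY [_ cardY] Yx xNJ yJ.
have -> : even_distances R m = distances Y.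
  apply: card_subset_eq (card_even_distances R m) cardY.
  rewrite -(distances_johnson R le_2m_n) => _ [u [v [uJ vJ uv ->]]].
  by exists u, v; split=> //; apply: JY.
by exists x, y; split=> //; [apply: JY|move=> xy; apply: xNJ; rewrite xy].
Qed.

(** * Integral translates and the added vectors *)

(** Termwise, z^2 - z is a product of consecutive integers, hence even. *)
Lemma sum_sqrz (n : nat) (z : 'I_n -> int) :
  exists w : int, \sum_i z i ^+ 2 = \sum_i z i + 2 * w.
Proof.
have [w wE] : exists w : int, \sum_i (z i ^+ 2 - z i) = 2 * w.
  elim/big_rec: _ => [|i y _ [w ->]]; first by exists 0; rewrite mulr0.
  have [v ->] : exists v : int, z i ^+ 2 - z i = 2 * v.
    exists ((z i ^+ 2 - z i) %/ 2)%Z; rewrite mulrC divzK //.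
    have [->|->] : z i = 2 * (z i %/ 2)%Z \/ z i = 2 * (z i %/ 2)%Z + 1 by lia.
      by rewrite dvdzE; nia.
    by rewrite dvdzE; nia.
  by exists (v + w); rewrite mulrDr.
by exists w; rewrite -wE sumrB addrC subrK.
Qed.

(** The [z i] sum to [#|A|] - n c, so in the expansion the terms in c [#|A|] cancel and only - n c^2
    is left beside an integer. *)
Lemma sqdist_shift (R : realType) (n : nat) (x : 'rV[R]_n) (c : R)
    (z : 'I_n -> int) (A : {set 'I_n}) :
  (forall i, x 0 i = c + (z i)%:~R) -> \sum_i x 0 i = #|A|%:R ->
  sqdist x (indicator R A) =
    (\sum_i z i ^+ 2 + #|A|%:Z - 2 * \sum_(i in A) z i)%:~R - n%:R * c ^+ 2.
Proof.
move=> xE sum_x; rewrite sqdist_indicator.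
have sum_sqr : \sum_i x 0 i ^+ 2 =
    n%:R * c ^+ 2 + 2 * c * (\sum_i z i)%:~R + (\sum_i z i ^+ 2)%:~R.
  have -> : n%:R * c ^+ 2 = \sum_(i < n) c ^+ 2.
    by rewrite sumr_const card_ord mulr_natl.
  rewrite !rmorph_sum mulr_sumr -!big_split; apply: eq_bigr => i _ /=.
  by rewrite xE rmorphXn /=; ring.
have sum_A : \sum_(i in A) x 0 i = #|A|%:R * c + (\sum_(i in A) z i)%:~R.
  rewrite (eq_bigr _ (fun i _ => xE i)) big_split sumr_const rmorph_sum /=.
  by rewrite mulr_natl.
have sum_xz : #|A|%:R = n%:R * c + (\sum_i z i)%:~R.
  rewrite -sum_x (eq_bigr _ (fun i _ => xE i)) big_split sumr_const card_ord.
  by rewrite rmorph_sum /= mulr_natl.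
rewrite sum_sqr sum_A rmorphB rmorphD rmorphM /= -pmulrn.
by rewrite sum_xz; ring.
Qed.

(** For c = n_0 / n, the number n c^2 is an integer [q] with the parity of n_0, which makes the
    squared distance an even integer. It is positive since [x] is not the indicator, so an upper
    bound suffices. *)
Lemma even_distances_shift (R : realType) (n m : nat) (x : 'rV[R]_n)
    (z : 'I_n -> int) (A : {set 'I_n}) :
  (0 < n)%N -> #|A| = m -> x <> indicator R A ->
  (forall i, x 0 i = (n_zero n)%:R / n%:R + (z i)%:~R) ->
  \sum_i x 0 i = m%:R -> sqdist x (indicator R A) <= (2 * m)%:R ->
  even_distances R m (eucl_dist x (indicator R A)).
Proof.
move=> n_gt0 cardA x_neq xE sum_x le_2m; apply/even_distances_eucl.
(* The divisibility criterion is used with [t = n_zero n]. *)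
have [q n0_sqr q_odd] : exists2 q,
    (n_zero n ^ 2 = n * q)%N & odd q = odd (n_zero n).
  by apply/n_zero_dvdn; rewrite ?n_zero_gt0.
have n_neq0 : n%:R != 0 :> R by rewrite pnatr_eq0 -lt0n.
have qE : n%:R * ((n_zero n)%:R / n%:R) ^+ 2 = q%:R :> R.
  have /(congr1 (fun k => k%:R : R)) := n0_sqr; rewrite natrX natrM => n0E.
  by rewrite expr_div_n n0E; field.
have sum_z : \sum_i z i = m%:Z - (n_zero n)%:Z.
  apply: (@intr_inj R); rewrite rmorphB rmorph_sum /= -!pmulrn -sum_x.
  rewrite (eq_bigr _ (fun i _ => xE i)) big_split sumr_const card_ord /=.
  by rewrite -mulr_natl; field.
have [w wE] := sum_sqrz z.
have [r rE] : exists r, (n_zero n + q = 2 * r)%N.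
  by exists ((n_zero n + q)./2); rewrite mul2n halfK oddD q_odd addbb subn0.
have dE : sqdist x (indicator R A) =
    (2 * (m%:Z - r%:Z + w - \sum_(i in A) z i))%:~R.
  rewrite (sqdist_shift xE) ?cardA // qE (pmulrn (1 : R) q) -rmorphB /=;
    congr _%:~R.
  by rewrite wE sum_z; lia.
have : 0 < sqdist x (indicator R A).
  by rewrite lt0r sqdist_ge0 sqdist_eq0 andbT; apply/eqP.
move: le_2m; rewrite dE (pmulrn (1 : R) (2 * m)) ler_int ltr0z.
case: (_ - _) => k; last by lia.
by move=> k_le k_gt0; exists k; [lia|rewrite pmulrn].
Qed.

(** One formula for the three cases: [x] is the constant n_0 / n plus a sign times the indicator of
    a set [B] of |m - n_0| positions. The sign is -1 exactly when m < n_0, and [B] is empty when m =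
    n_0. *)
Lemma added_vectors_shift (R : realType) (n m : nat) (x : 'rV[R]_n) :
  (m <= n)%N -> (n_zero n < n)%N ->
  added_vectors R n m x <->
  exists2 B : {set 'I_n},
    (-1) ^+ (m < n_zero n)%N * #|B|%:Z = m%:Z - (n_zero n)%:Z &
    forall i, x 0 i = (n_zero n)%:R / n%:R +
      ((-1) ^+ (m < n_zero n)%N * (i \in B)%:Z)%:~R.
Proof.
move=> le_mn lt_n0n; rewrite /added_vectors; case: ltnP => [lt_mn0|le_n0m].
  rewrite perm_vectors2P; [|by apply/eqP => cE; lra|by lia].
  split=> [[A cardA ->]|[B cardB xE]].
    (* [A] holds the positions of the value n_0 / n, its complement those of n_0 / n - 1. *)
    exists (~: A); first by rewrite mulN1r cardsCs finset.setCK card_ord cardA;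
      lia.
    by move=> i; rewrite mxE finset.in_setC mulN1r rmorphN /=;
      case: (i \in A) => /=; lra.
  move: cardB; rewrite mulN1r => cardB.
  exists (~: B); first by rewrite cardsCs finset.setCK card_ord; lia.
  apply/rowP => i; rewrite mxE xE finset.in_setC.
  by rewrite mulN1r rmorphN /=; case: (i \in B) => /=; lra.
rewrite expr0; case: eqP => [m_n0|m_neq]; last first.
  rewrite perm_vectors2P; [|by rewrite -subr_eq0 addrK oner_neq0|by lia].
  split=> [[A cardA ->]|[B cardB xE]].
    exists A; first by rewrite mul1r cardA; lia.
    by move=> i; rewrite mxE mul1r; case: (i \in A) => /=; lra.
  exists B; first by move: cardB; rewrite mul1r; lia.
  by apply/rowP => i; rewrite mxE xE mul1r; case: (i \in B) => /=; lra.
split=> [->|[B cardB xE]].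
  exists finset.set0; first by rewrite cards0 m_n0; lia.
  by move=> i; rewrite mxE inE m_n0 mulr0 addr0.
have /eqP : #|B| = 0%N by move: cardB; rewrite mul1r; lia.
rewrite cards_eq0 => /eqP B0; apply/rowP => i.
by rewrite xE B0 inE mxE m_n0 mulr0 addr0.
Qed.

(** * Sufficiency of the numerical conditions *)

Definition admissible (R : realType) (n m : nat) : Prop :=
  (n_zero n < n)%N /\
  3 * (n_zero n)%:R - (n_zero n)%:R ^+ 2 / n%:R <= 4 * m%:R :> R.

Arguments admissible R n m : clear implicits.

(** Refuting maximality requires an actual vector; |m - n_0| <= n leaves room for [B]. *)
Lemma added_vectors_nonempty (R : realType) (n m : nat) :
  (m <= n)%N -> (n_zero n < n)%N -> added_vectors R n m !=set0.
Proof.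
move=> le_mn lt_n0n.
have [|B _ cardB] := @ex_subset_card _ [set: 'I_n]%SET
    (if m < n_zero n then n_zero n - m else m - n_zero n)%N.
  by rewrite cardsT card_ord; case: ifP; lia.
exists (\row_i ((n_zero n)%:R / n%:R +
  ((-1) ^+ (m < n_zero n)%N * (i \in B)%:Z)%:~R)).
apply/added_vectors_shift => //; exists B; last by move=> i; rewrite mxE.
by rewrite cardB; case: ltnP => ?; rewrite ?mulN1r ?mul1r; lia.
Qed.

Lemma sum_mulr_mem (n : nat) (e : int) (A B : {set 'I_n}) :
  \sum_(i in A) e * (i \in B)%:Z = e * #|A :&: B|%:Z.
Proof.
rewrite -mulr_sumr; congr (e * _).
rewrite -sum1_card -natz natr_sum big_mkcond [RHS]big_mkcond.
apply: eq_bigr => i _; rewrite finset.in_setI.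
by case: (i \in A); case: (i \in B).
Qed.

(** Parity comes from [even_distances_shift]. It remains to see that [x] is not integral, as 0 < c <
    1, and that no squared distance exceeds [2 * m]. *)
Lemma added_vectors_spec (R : realType) (n m : nat) (x : 'rV[R]_n) :
  (1 <= m)%N -> (2 * m <= n)%N -> admissible R n m -> added_vectors R n m x ->
  [/\ sum_hyperplane R n m x, ~ johnson R n m x &
    forall y, johnson R n m y -> even_distances R m (eucl_dist x y)].
Proof.
move=> hm hn [lt_n0n le_4m]; have le_mn : (m <= n)%N by lia.
move=> /(added_vectors_shift _ le_mn lt_n0n)[B].
set e := (-1) ^+ _; set n0 := n_zero n in lt_n0n le_4m e *; set c := n0%:R / _.
move=> cardB xE.
have n_gt0 : 0 < n%:R :> R by rewrite ltr0n; lia.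
have n_neq0 : n%:R != 0 :> R by rewrite gt_eqF.
have c_gt0 : 0 < c by rewrite divr_gt0 // ltr0n n_zero_gt0.
have c_lt1 : c < 1 by rewrite ltr_pdivrMr // mul1r ltr_nat.
have e2 : e ^+ 2 = 1 by rewrite sqrr_sign.
have sum_z : \sum_i e * (i \in B)%:Z = m%:Z - n0%:Z.
  transitivity (\sum_(i in [set: 'I_n]%SET) e * (i \in B)%:Z).
    by apply: eq_bigl => i; rewrite inE.
  by rewrite sum_mulr_mem finset.setTI cardB.
have sum_z2 : \sum_i (e * (i \in B)%:Z) ^+ 2 = #|B|%:Z.
  transitivity (\sum_(i in [set: 'I_n]%SET) 1 * (i \in B)%:Z).
    apply: eq_big => i; first by rewrite inE.
    by rewrite exprMn e2; case: (i \in B).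
  by rewrite sum_mulr_mem finset.setTI mul1r.
have sum_x : \sum_i x 0 i = m%:R.
  rewrite (eq_bigr _ (fun i _ => xE i)) big_split sumr_const card_ord /=.
  rewrite -rmorph_sum sum_z rmorphB /= -!pmulrn -mulr_natl /c; field.
  exact: n_neq0.
have xNJ : ~ johnson R n m x.
  move=> /(johnsonP _ le_mn)[A _ xA].
  (* Any coordinate will do: it would make [c] an integer strictly between 0 and 1. *)
  have n_gt0' : (0 < n)%N by lia.
  have := xE (Ordinal n_gt0'); rewrite xA mxE; set i := Ordinal _.
  move=> cE; have {}cE : c = ((i \in A)%:Z - e * (i \in B)%:Z)%:~R.
    by rewrite rmorphB /= -pmulrn cE addrK.
  by move: c_gt0 c_lt1; rewrite cE ltr0z ltrz1; lia.
split=> // y /[dup] yJ /(johnsonP _ le_mn)[A cardA yA].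
rewrite yA; apply: (even_distances_shift _ cardA _ xE sum_x).
- by lia.
- by move=> xA; apply: xNJ; rewrite xA -yA.
clearbody n0.
rewrite (sqdist_shift xE) ?cardA // sum_z2 sum_mulr_mem.
have -> : n%:R * c ^+ 2 = n0%:R ^+ 2 / n%:R by rewrite /c; field.
have AB_le : (#|A :&: B| <= #|B|)%N by rewrite subset_leq_card ?finset.subsetIr.
have q_ge0 : 0 <= n0%:R ^+ 2 / n%:R :> R by rewrite divr_ge0 ?sqr_ge0 ?ler0n.
move: cardB; rewrite /e; case: ltnP => [lt_mn0|le_n0m];
  rewrite ?mulN1r ?mul1r => cardB.
  (* The worst case is [#|A :&: B|] = [#|B|] = n_0 - m. After subtracting n_0^2 / n, the bound
     [le_4m] leaves at most 2 m. *)
  have le_int : #|B|%:Z + m%:Z - 2 * (- #|A :&: B|%:Z) <= 3 * n0%:Z - 2 * m%:Z.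
    by lia.
  move: le_int; rewrite -(ler_int R) [X in _ <= X]rmorphB !rmorphM /= -!pmulrn
    natrM.
  lra.
(* Here [#|B|] = m - n_0 is at most m, and n_0^2 / n is nonnegative. *)
have le_int : #|B|%:Z + m%:Z - 2 * #|A :&: B|%:Z <= 2 * m%:Z by lia.
by move: le_int; rewrite -(ler_int R) [X in _ <= X]rmorphM /= -!pmulrn natrM;
  lra.
Qed.

(** * Necessity *)

Section Necessity.
Variables (R : realType) (n m : nat) (x : 'rV[R]_n).
Hypotheses (hm : (1 <= m)%N) (hn : (2 * m <= n)%N).
Hypothesis sum_x : \sum_i x 0 i = m%:R.
Hypothesis x_dist : forall A : {set 'I_n}, #|A| = m ->
  exists2 k, (0 < k <= m)%N & sqdist x (indicator R A) = (2 * k)%:R.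

(** Exchanging [i] for [j] beside a common part [C] of size m - 1 changes the squared distance by 2
    (x_i - x_j), which is a difference of even integers. *)
Lemma int_coord_diff (i j : 'I_n) : x 0 i - x 0 j \is a Num.int.
Proof.
have [->|i_neq_j] := eqVneq i j; first by rewrite subrr.
have [|C Cij cardC] := @ex_subset_card _ (~: [set i; j]%SET) m.-1.
  by rewrite cardsCs finset.setCK card_ord cards2 i_neq_j /=; lia.
have iNC : i \notin C.
  by apply/negP => /(fintype.subsetP Cij); rewrite !inE eqxx.
have jNC : j \notin C.
  by apply/negP => /(fintype.subsetP Cij); rewrite !inE eqxx orbT.
have [|k _] := x_dist (A := (i |: C)%SET);
  first by rewrite cardsU1 iNC /= cardC; lia.
have [|l _] := x_dist (A := (j |: C)%SET);
  first by rewrite cardsU1 jNC /= cardC; lia.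
rewrite !sqdist_indicator !cardsU1 iNC jNC !big_setU1 //= !natrM => dj di.
have -> : x 0 i - x 0 j = (l%:Z - k%:Z)%:~R.
  by rewrite rmorphB /= -!pmulrn; lra.
exact: intr_int.
Qed.

(** [A] and [B] carry the [m] largest and the [m] smallest coordinates; [a] is a value attained on
    both, which pins every other coordinate to [a]. *)
Lemma median_coord : exists (A B : {set 'I_n}) (a : R),
  [/\ #|A| = m, #|B| = m & forall i, i \in B -> i \notin A] /\
  [/\ \sum_(i in A) x 0 i - \sum_(i in B) x 0 i <= m.-1%:R,
      forall i, i \in A -> a <= x 0 i, forall i, i \in B -> x 0 i <= a,
      forall i, i \notin A -> i \notin B -> x 0 i = a &
      forall i, x 0 i - a \is a Num.int].
Proof.
have [|A [_ cardA topA]] := @ex_top_subset _ _ _ (x 0) [set: 'I_n]%SET m.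
  by rewrite cardsT card_ord; lia.
have [|B [BA cardB topB]] := @ex_top_subset _ _ _ (fun i => - x 0 i) (~: A) m.
  by rewrite cardsCs finset.setCK card_ord cardA; lia.
have {}topA i j : i \in A -> j \notin A -> x 0 j <= x 0 i.
  by move=> iA jA; apply: topA; rewrite ?inE.
have {}topB i j : i \in B -> j \notin A -> j \notin B -> x 0 i <= x 0 j.
  by move=> iB jA jB; rewrite -lerN2; apply: topB; rewrite ?inE.
have BNA i : i \in B -> i \notin A.
  by move/(fintype.subsetP BA); rewrite inE.
(* The squared distances 2 k to [A] and 2 l to [B] give a difference of sums equal to l - k, where k
   >= 1 and l <= m. *)
have le_AB : \sum_(i in A) x 0 i - \sum_(i in B) x 0 i <= m.-1%:R.
  have [k /andP[k_gt0 _]] := x_dist cardA.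
  have [l /andP[_ l_le]] := x_dist cardB.
  rewrite !sqdist_indicator cardA cardB !natrM => dB dA.
  have : (l + 1 <= k + m)%N by lia.
  have : m%:R = m.-1%:R + 1 :> R by rewrite -[1]/(1%:R) -natrD addn1 prednK.
  by rewrite -(ler_nat R) !natrD => mE le_lk; move: k_gt0;
    rewrite -(ltr_nat R); lra.
have [s [t [sA tB st]]] : exists s t, [/\ s \in A, t \in B & x 0 s = x 0 t].
  apply: contrapT => no_st.
  have lt_st s t : s \in A -> t \in B -> 1 <= x 0 s - x 0 t.
    move=> sA tB; have /intrP[k kE] := int_coord_diff s t.
    have : 0 <= x 0 s - x 0 t by rewrite subr_ge0 topA ?BNA.
    have : x 0 s - x 0 t != 0.
      by apply/eqP => /subr0_eq st; apply: no_st; exists s, t.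
    by rewrite kE intr_eq0 ler0z ler1z; lia.
  (* Summing over all m^2 pairs would give m^2 <= m (m - 1). *)
  have : \sum_(s in A) \sum_(t in B) 1 <=
      \sum_(s in A) \sum_(t in B) (x 0 s - x 0 t).
    by apply: ler_sum => s sA; apply: ler_sum => t tB; apply: lt_st.
  have -> : \sum_(s in A) \sum_(t in B) (x 0 s - x 0 t) =
      m%:R * (\sum_(i in A) x 0 i - \sum_(i in B) x 0 i).
    under eq_bigr => s _ do rewrite sumrB sumr_const cardB -mulr_natl.
    rewrite sumrB sumr_const cardA -mulr_sumr mulrBr.
    by rewrite [in RHS](mulr_natl (\sum_(i in B) _)).
  rewrite !sumr_const cardA cardB -(mulr_natl m%:R) ler_pM2l ?ltr0n //.
  by move=> /le_trans/(_ le_AB); rewrite ler_nat; lia.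
exists A, B, (x 0 s); split=> //; split=> // [i iA|i iB|i iA iB|i].
- by rewrite st topA ?BNA.
- by rewrite topA ?BNA.
- by apply/le_anti; rewrite topA //= st topB.
- exact: int_coord_diff.
Qed.

(** With x_i = a + z_i, the integer t = n a is shown to be a multiple of n_0 below n that satisfies
    the inequality, which then descends to n_0. *)
Lemma admissible_of_distances : admissible R n m.
Proof.
have [A [B [a [[cardA cardB BNA] [le_AB geA leB eqAB x_int]]]]] := median_coord.
have [z xE] : exists z : 'I_n -> int, forall i, x 0 i = a + (z i)%:~R.
  exists (fun i => Num.floor (x 0 i - a)) => i.
  by move: (x_int i); rewrite intrEfloor => /eqP ->; rewrite addrC subrK.
have zA i : i \in A -> 0 <= z i.
  by move=> /geA; rewrite xE lerDl ler0z.
have zB i : i \in B -> z i <= 0.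
  by move=> /leB; rewrite xE gerDl lerz0.
have z0 i : i \notin A -> i \notin B -> z i = 0.
  move=> iA iB; apply/eqP; rewrite -(intr_eq0 R) -(inj_eq (addrI a)) -xE addr0.
  by rewrite eqAB.
(* [P] and [N] are the total positive and negative parts of [z]. *)
set P := \sum_(i in A) z i; set N := - \sum_(i in B) z i.
have P_ge0 : 0 <= P by apply: sumr_ge0.
have N_ge0 : 0 <= N by rewrite oppr_ge0; apply: sumr_le0.
have sum_z : \sum_i z i = P - N.
  rewrite /P /N opprK !(big_mkcond (fun i => i \in _)) -big_split /=.
  apply: eq_bigr => i _; case: ifP => [iA|/negbT iA].
    by rewrite ifN ?addr0 //; apply: contraL iA => /BNA.
  by case: ifP => [|/negbT iB]; rewrite ?add0r // z0.
(* An integer satisfies z^2 >= |z|. *)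
have sum_z2 : P + N <= \sum_i z i ^+ 2.
  rewrite /P /N -sumrN !(big_mkcond (fun i => i \in _)) -big_split /=.
  apply: ler_sum => i _; case: ifP => [iA|_]; case: ifP => [iB|_].
  - by have := BNA i iB; rewrite iA.
  - by have := zA i iA; nia.
  - by have := zB i iB; nia.
  - by rewrite addr0 sqr_ge0.
have sum_over (D : {set 'I_n}) : \sum_(i in D) x 0 i = #|D|%:R * a + (\sum_(i
  in D) z i)%:~R.
  rewrite (eq_bigr _ (fun i _ => xE i)) big_split sumr_const rmorph_sum /=.
  by rewrite mulr_natl.
have PN_lt : P + N <= m%:Z - 1.
  have -> : m%:Z - 1 = m.-1%:Z by lia.
  rewrite -(ler_int R) -pmulrn; apply: le_trans le_AB.
  by rewrite !sum_over cardA cardB /N rmorphD rmorphN /= -/P; lra.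
(* [PN_lt] gives P, N <= m - 1, whence 0 < t <= 2 m - 1 < n. *)
have [t tE] : exists t : nat, t%:Z = m%:Z - P + N.
  by exists (absz (m%:Z - P + N)); lia.
have n_gt0 : 0 < n%:R :> R by rewrite ltr0n; lia.
have n_neq0 : n%:R != 0 :> R by rewrite gt_eqF.
have aE : n%:R * a = t%:R.
  have <- : #|[set: 'I_n]%SET| = n by rewrite cardsT card_ord.
  have := sum_over [set: 'I_n]%SET.
  have sumT (V : nmodType) (f : 'I_n -> V) :
      \sum_(i in [set: 'I_n]%SET) f i = \sum_i f i.
    by apply: eq_bigl => i; rewrite inE.
  rewrite !sumT sum_x sum_z => mE.
  by rewrite (pmulrn (1 : R) t) tE rmorphD !rmorphB /= -pmulrn mE rmorphB /=;
    ring.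
have n_a2 : n%:R * a ^+ 2 = t%:R ^+ 2 / n%:R.
  by rewrite -aE; field.
have t_gt0 : (0 < t)%N by lia.
have t_lt : (t < n)%N by lia.
(* The quotient t^2 / n = n a^2 differs from the integer [d] by an even number, and [d] has the
   parity of m + P - N, that is, of t. *)
have n0t : (n_zero n %| t)%N.
  apply/n_zero_dvdn => //; first by lia.
  have [k _] := x_dist cardA.
  rewrite (sqdist_shift xE) ?cardA // -/P; set d := (_ + _ - _) => dE.
  have q_int : n%:R * a ^+ 2 = (d - (2 * k)%:Z)%:~R.
    by rewrite rmorphB /= -pmulrn -dE; ring.
  have q_ge0 : 0 <= d - (2 * k)%:Z.
    by rewrite -(ler0z R) -q_int mulr_ge0 ?sqr_ge0 ?ltW.
  have [q qE] : exists q : nat, q%:Z = d - (2 * k)%:Z.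
    by exists (absz (d - (2 * k)%:Z)); lia.
  exists q.
    apply/eqP; rewrite -(eqr_nat R) natrX natrM (pmulrn (1 : R) q) qE -q_int.
    by rewrite n_a2; apply/eqP; field.
  by have [w wE] := sum_sqrz z; move: qE; rewrite /d wE sum_z; lia.
have n0_le_t : (n_zero n <= t)%N by rewrite dvdn_leq.
split; first by lia.
have [k /andP[_ k_le]] := x_dist cardB.
rewrite (sqdist_shift xE) ?cardB // n_a2 => dE.
have t_le : 3 * t%:R - t%:R ^+ 2 / n%:R <= 4 * m%:R :> R.
  (* The right-hand side is at least m + P + 3 N, while the left-hand side is m - 3 P + 3 N. *)
  have : 3 * t%:Z - 2 * m%:Z <=
      \sum_i z i ^+ 2 + m%:Z - 2 * \sum_(i in B) z i by lia.
  rewrite -(ler_int R) rmorphB !rmorphM /= -!pmulrn.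
  by move: dE k_le; rewrite -(ler_nat R) natrM; lra.
apply: le_trans t_le.
rewrite -subr_ge0.
(* This factorisation gives monotonicity: both factors are nonnegative for n_0 <= t < n. *)
have -> : 3 * t%:R - t%:R ^+ 2 / n%:R -
      (3 * (n_zero n)%:R - (n_zero n)%:R ^+ 2 / n%:R) =
    (t%:R - (n_zero n)%:R) * (3 * n%:R - t%:R - (n_zero n)%:R) / n%:R :> R.
  by field.
move: n0_le_t t_lt; rewrite -(ler_nat R) -(ltr_nat R) => n0_le_t t_lt.
by rewrite divr_ge0 ?(ltW n_gt0) ?mulr_ge0 //; lra.
Qed.

End Necessity.

(** * The equivalence with non-maximality *)

Lemma johnson_sum (R : realType) (n m : nat) (y : 'rV[R]_n) : (m <= n)%N ->
  johnson R n m y -> sum_hyperplane R n m y.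
Proof.
move=> le_mn /(johnsonP _ le_mn)[A cardA ->]; rewrite /sum_hyperplane /=.
under eq_bigr => i _ do rewrite -[_ 0 i]mul1r.
by rewrite sum_indicator sumr_const cardA.
Qed.

Theorem theorem1 (R : realType) (n m : nat)
    (hm : (1 <= m)%N) (hn : (2 * m <= n)%N) :
  let n0 := n_zero n in
  let admissible : Prop :=
    (n0 < n)%N /\ 3 * n0%:R - n0%:R ^+ 2 / n%:R <= 4 * m%:R :> R in
  (~ maximal_distance_set m (sum_hyperplane R n m) (johnson R n m)
     <-> admissible) /\
  (admissible ->
     forall x : 'rV[R]_n, added_vectors R n m x ->
       [/\ sum_hyperplane R n m x, ~ johnson R n m x &
           distance_set m (johnson R n m `|` [set x])]).
Proof.
move=> n0 adm; have le_mn : (m <= n)%N by lia.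
have n0_adm : adm -> forall x : 'rV[R]_n, added_vectors R n m x ->
    [/\ sum_hyperplane R n m x, ~ johnson R n m x &
        distance_set m (johnson R n m `|` [set x])].
  move=> n_adm x /(added_vectors_spec hm hn n_adm)[xH xNJ x_dist].
  by split=> //; apply: distance_set_johnsonU1.
split=> //; split=> [not_max|n_adm [_ _ maxJ]]; last first.
  have [x x_added] := added_vectors_nonempty R le_mn n_adm.1.
  have [xH xNJ xJ] := n0_adm n_adm x x_added.
  (* Maximality would identify the enlarged set with the Johnson set and so put [x] in the
     latter. *)
  apply: xNJ; rewrite -(maxJ _ _ _ xJ) => [|y [/(johnson_sum le_mn)|->]|y] //.
  - by right.
  - by left.
(* The Johnson set meets the first two clauses of maximality, so the third must fail. *)
have [Y [YH JY dY YJ]] : exists Y, [/\ Y `<=` sum_hyperplane R n m,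
    johnson R n m `<=` Y, distance_set m Y & Y <> johnson R n m].
  apply: contrapT => no_Y; apply: not_max; split.
  - by move=> y /(johnson_sum le_mn).
  - exact: distance_set_johnson.
  - move=> Y YH JY dY; apply: contrapT => YJ; apply: no_Y.
    by exists Y.
have [x Yx xNJ] : exists2 x, Y x & ~ johnson R n m x.
  apply: contrapT => no_x; apply: YJ; apply/seteqP; split=> // x Yx.
  by apply: contrapT => xNJ; apply: no_x; exists x.
apply: (@admissible_of_distances R n m x) => // [|A cardA]; first exact: YH.
apply/even_distances_eucl; apply: (distance_set_johnson_sup hn JY dY) => //.
by apply/johnsonP => //; exists A.
Qed.
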